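(* For all $(u,v)\in [0,1]^2$ put $Q(u,v)=(u+v-1)\min(1-u,v)\min(u,1-v)$. Then the mapping $$C(u,v)=uv+Q(u,v)=uv+(u+v-1)\min(1-u,v)\min(u,1-v),\qquad (u,v)\in[0,1]^2,$$ defines a copula.
   Context: A (bivariate) copula is a function $C:[0,1]^2\to[0,1]$ such that, for all $u,v\in[0,1]$: (1) $C(0,v)=C(u,0)=0$; (2) $C(1,v)=v$ and $C(u,1)=u$; (3) for every rectangle $[u_1,u_2]\times[v_1,v_2]\subset[0,1]^2$ with $u_1<u_2$ and $v_1<v_2$, $C(u_2,v_2)-C(u_2,v_1)-C(u_1,v_2)+C(u_1,v_1)\ge 0$. *)

(* Defs.v *)
From mathcomp Require Import all_boot all_order all_algebra.
From mathcomp Require Import reals.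

Set Implicit Arguments.
Unset Strict Implicit.
Unset Printing Implicit Defensive.

Import Order.TTheory GRing.Theory Num.Theory.
Local Open Scope ring_scope.

(* A map [0,1]^2 -> [0,1] is represented by a total function R -> R -> R of
   which only the values on the unit square are constrained. *)
Definition copula (R : realType) (C : R -> R -> R) : Prop :=
  [/\ forall u v, 0 <= u <= 1 -> 0 <= v <= 1 -> 0 <= C u v <= 1,
      forall u v, 0 <= u <= 1 -> 0 <= v <= 1 -> C 0 v = 0 /\ C u 0 = 0,
      forall u v, 0 <= u <= 1 -> 0 <= v <= 1 -> C 1 v = v /\ C u 1 = u
    & forall u1 u2 v1 v2,
        0 <= u1 <= 1 -> 0 <= u2 <= 1 -> 0 <= v1 <= 1 -> 0 <= v2 <= 1 ->
        u1 < u2 -> v1 < v2 ->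
        0 <= C u2 v2 - C u2 v1 - C u1 v2 + C u1 v1].

Definition Q (R : realType) (u v : R) : R :=
  (u + v - 1) * Num.min (1 - u) v * Num.min u (1 - v).

(* Main.v *)
(** On [u + v <= 1] the map is [u v (u + v)]; on [1 <= u + v] it is
    [u v + (u + v - 1) (1 - u) (1 - v)].  For [v1 < v2] the lines
    [u = 1 - v2] and [u = 1 - v1] cut the range of [u] into three pieces, on
    each of which [C u v2 - C u v1] is a quadratic polynomial in [u] whose
    secant slopes are visibly nonnegative; hence it is nondecreasing. *)

Require Import Defs.
From mathcomp Require Import all_boot all_order all_algebra.
From mathcomp Require Import reals.
From mathcomp Require Import ring lra.


Set Implicit Arguments.
Unset Strict Implicit.
Unset Printing Implicit Defensive.

Import Order.TTheory GRing.Theory Num.Theory.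
Local Open Scope ring_scope.

(** If [a] separates [x] from [y], compare through [f a]; this is where [P a] enters. *)
Lemma nondecreasing_glue (R : realDomainType) (P : pred R) (f : R -> R) (a : R) :
    P a ->
    (forall x y, P x -> P y -> x <= y -> y <= a -> f x <= f y) ->
    (forall x y, P x -> P y -> a <= x -> x <= y -> f x <= f y) ->
  {in P &, {homo f : x y / x <= y}}.
Proof.
move=> Pa f_le f_ge x y Px Py xy.
have [ya|/ltW ay] := leP y a; first exact: f_le.
have [xa|/ltW ax] := leP x a; last exact: f_ge.
by apply: (@le_trans _ _ (f a)); [exact: f_le | exact: f_ge].
Qed.

Section CubicCopula.
Variable R : realType.
Implicit Types u v : R.

Let C u v := u * v + Q u v.

Lemma cubic_lower u v : u + v <= 1 -> C u v = u * v * (u + v).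
Proof.
move=> uv; have -> : C u v = u * v + (u + v - 1) * v * u.
  by rewrite /C /Q min_r ?min_l //; lra.
ring.
Qed.

Lemma cubic_upper u v :
  1 <= u + v -> C u v = u * v + (u + v - 1) * (1 - u) * (1 - v).
Proof. by move=> uv; rewrite /C /Q min_l ?min_r //; lra. Qed.

Lemma cubic_diff_nondecreasing v1 v2 : 0 <= v1 -> v1 <= v2 -> v2 <= 1 ->
  {in [pred u | 0 <= u <= 1] &,
    {homo (fun u => C u v2 - C u v1) : x y / x <= y}}.
Proof.
move=> v1_ge0 v12 v2_le1.
apply: (@nondecreasing_glue _ _ _ (1 - v2)) => [|x y /=|]; first by rewrite /=; lra.
  move=> /andP[x0 _] _ xy yv2; rewrite !cubic_lower; try lra.
  rewrite -subr_ge0.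
  have -> : y * v2 * (y + v2) - y * v1 * (y + v1)
            - (x * v2 * (x + v2) - x * v1 * (x + v1))
          = (y - x) * ((v2 - v1) * (x + y + v1 + v2)) by ring.
  by rewrite !mulr_ge0; lra.
(* Right of the first cut, glue again at the second cut [1 - v1]. *)
have homo_above : {in [pred u | 1 - v2 <= u] &,
    {homo (fun u => C u v2 - C u v1) : x y / x <= y}}.
  apply: (@nondecreasing_glue _ _ _ (1 - v1))
    => [|x y /= xv2 _ xy yv1|x y _ _ xv1 xy].
  - by rewrite /=; lra.
  - rewrite !(cubic_upper (v := v2)); try lra.
    rewrite !(cubic_lower (v := v1)); try lra.
    rewrite -subr_ge0; set d := (X in 0 <= X).
    (* The secant slope is affine and nonincreasing in [x + y]; it is expanded around
       [x = y = 1 - v1], the right end of this piece, where it equals [(v2 - v1) ^+ 2]. *)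
    have -> : d = (y - x) * ((v2 - v1) ^+ 2
                  + (1 - v2 + v1) * (2 * (1 - v1) - (x + y))).
      by rewrite /d; ring.
    rewrite mulr_ge0 ?subr_ge0 //.
    by apply: addr_ge0; [exact: sqr_ge0 | rewrite mulr_ge0; lra].
  - rewrite !cubic_upper; try lra.
    rewrite -subr_ge0; set d := (X in 0 <= X).
    (* Here [x + y >= 2 * (1 - v1)], so the last factor is at least [v2 - v1]. *)
    have -> : d = (y - x) * ((v2 - v1) * (x + y + v1 + v2 - 2)).
      by rewrite /d; ring.
    by rewrite !mulr_ge0; lra.
by move=> x y _ _ xv2 xy; apply: homo_above; rewrite ?inE //; lra.
Qed.

Lemma cubic_itv01 u v : 0 <= u <= 1 -> 0 <= v <= 1 -> 0 <= C u v <= 1.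
Proof.
move=> /andP[u0 u1] /andP[v0 v1].
have uv0 : 0 <= u * v by exact: mulr_ge0.
have uv1 : u * v <= 1 by exact: mulr_ile1.
have [uv|/ltW uv] := leP (u + v) 1.
  by rewrite cubic_lower // mulr_ge0 ?mulr_ile1 //; lra.
have w0 : 0 <= (1 - u) * (1 - v) by rewrite mulr_ge0; lra.
rewrite cubic_upper // -mulrA; apply/andP; split.
  by rewrite addr_ge0 // mulr_ge0 //; lra.
(* The two summands are bounded by [u] and [1 - u], which add up to 1. *)
have : (u + v - 1) * ((1 - u) * (1 - v)) <= (1 - u) * (1 - v).
  by rewrite ler_piMl //; lra.
have : u * v <= u by rewrite ler_piMr.
have : (1 - u) * (1 - v) <= 1 - u by rewrite ler_piMr; lra.
lra.
Qed.

End CubicCopula.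

Theorem theorem12 (R : realType) : copula (fun u v : R => u * v + Q u v).
Proof.
split.
- exact: cubic_itv01.
- move=> u v /andP[u0 u1] /andP[v0 v1].
  (* The edges [u = 0] and [v = 0] lie in [u + v <= 1]; the opposite edges lie in [1 <= u + v]. *)
  by split; rewrite cubic_lower; [ring|lra|ring|lra].
- move=> u v /andP[u0 u1] /andP[v0 v1].
  by split; rewrite cubic_upper; [ring|lra|ring|lra].
move=> u1 u2 v1 v2 u1P u2P /andP[v1_ge0 _] /andP[_ v2_le1] /ltW u12 /ltW v12.
(* The rectangle's volume is the growth of [C u v2 - C u v1] from [u1] to [u2]. *)
have := cubic_diff_nondecreasing v1_ge0 v12 v2_le1 u1P u2P u12.
lra.
Qed.
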